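(* The (decision version of the) bottleneck pyramidal TSP on $n$ points in the Euclidean plane has a lower bound of $\Omega(n\log n)$ in the algebraic computation tree model: deciding, for a linearly ordered set $P$ of $n$ points in the plane and a value $B>0$, whether $P$ admits a pyramidal tour whose longest edge has Euclidean length at most $B$, requires $\Omega(n\log n)$ time in this model.
   Context: For a linear order $p_1,\ldots,p_n$ of the points, a pyramidal tour is a Hamiltonian cycle on the points of the form $(p_1,p_{i_1},\ldots,p_{i_r},p_n,p_{j_1},\ldots,p_{j_{n-r-2}})$ with $i_1<i_2<\cdots<i_r$ and $j_1>j_2>\cdots>j_{n-r-2}$. *)

(* Defs.v *)
From Stdlib Require Import Reals.
From mathcomp Require Import all_boot.

Set Implicit Arguments.
Unset Strict Implicit.
Unset Printing Implicit Defensive.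

Definition edist (p q : R * R) : R :=
  sqrt (Rplus (Rsqr (Rminus (fst p) (fst q))) (Rsqr (Rminus (snd p) (snd q)))).

(* ---------- Pyramidal tours ----------
   Points are indexed 0..n-1 in their linear order (p_1 = index 0,
   p_n = index n-1).  A tour is given as the cyclic sequence of visited
   indices.  It is pyramidal iff it is a Hamiltonian cycle (a permutation
   of 0..n-1) of the form 0 :: a ++ (n-1) :: b with a strictly increasing
   and b strictly decreasing. *)
Definition pyramidal (n : nat) (t : seq nat) : Prop :=
  perm_eq t (iota 0 n) /\
  exists a b : seq nat,
    t = 0%N :: a ++ n.-1 :: b /\ sorted ltn a /\ sorted (fun x y => y < x) b.

Definition bottleneck_le (pts : nat -> R * R) (t : seq nat) (B : R) : Prop :=
  forall k : nat, (k < size t)%N ->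
    Rle (edist (pts (nth 0%N t k)) (pts (nth 0%N t ((k.+1) %% size t)))) B.

Definition BPTSP_yes (n : nat) (pts : nat -> R * R) (B : R) : Prop :=
  exists t : seq nat, pyramidal n t /\ bottleneck_le pts t B.

(* ---------- Algebraic computation trees (Ben-Or) ----------
   Operands: an input variable, a previously computed value, or an
   arbitrary real constant.  Internal nodes: an arithmetic operation
   (+, -, *, /) or a square root, each storing a new value, or a
   three-way sign test.  Leaves: accept / reject.
   Conventions for partial operations: x / 0 and sqrt of a negative are
   given the values of Stdlib's total functions; these can be simulated
   by a constant number of extra nodes, so they do not affect the
   asymptotic model. *)
Inductive operand : Type :=
| In  : nat -> operand
| Val : nat -> operand
| Cst : R -> operand.

Inductive binop : Type := OAdd | OSub | OMul | ODiv.

Inductive act : Type :=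
| Leaf   : bool -> act
| Op     : binop -> operand -> operand -> act -> act
| Sqrt   : operand -> act -> act
| Branch : operand -> act -> act -> act -> act.  (* < 0 | = 0 | > 0 *)

Definition operand_val (inp env : seq R) (o : operand) : R :=
  match o with
  | In i => nth R0 inp i
  | Val j => nth R0 env j
  | Cst c => c
  end.

Definition binop_val (o : binop) (x y : R) : R :=
  match o with
  | OAdd => Rplus x y
  | OSub => Rminus x y
  | OMul => Rmult x y
  | ODiv => Rdiv x y
  end.

Fixpoint act_eval (T : act) (inp env : seq R) : bool :=
  match T with
  | Leaf b => b
  | Op o a b k =>
      act_eval k inp (rcons env (binop_val o (operand_val inp env a)
                                              (operand_val inp env b)))
  | Sqrt a k => act_eval k inp (rcons env (sqrt (operand_val inp env a)))
  | Branch a tl te tg =>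
      match total_order_T (operand_val inp env a) R0 with
      | inleft (left _) => act_eval tl inp env
      | inleft (right _) => act_eval te inp env
      | inright _ => act_eval tg inp env
      end
  end.

(* running time = depth = number of nodes on the longest root-leaf path *)
Fixpoint act_depth (T : act) : nat :=
  match T with
  | Leaf _ => 0
  | Op _ _ _ k => (act_depth k).+1
  | Sqrt _ k => (act_depth k).+1
  | Branch _ tl te tg => (maxn (act_depth tl) (maxn (act_depth te) (act_depth tg))).+1
  end.

Definition encode (n : nat) (pts : nat -> R * R) (B : R) : seq R :=
  flatten [seq [:: fst (pts i); snd (pts i)] | i <- iota 0 n] ++ [:: B].

Definition decides_BPTSP (n : nat) (T : act) : Prop :=
  forall (pts : nat -> R * R) (B : R),
    Rlt R0 B ->
    (forall i j : nat, (i < n)%N -> (j < n)%N -> i <> j -> pts i <> pts j) ->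
    (act_eval T (encode n pts B) [::] = true <-> BPTSP_yes n pts B).

(* Main.v *)
From Stdlib Require Import Reals.
From mathcomp Require Import all_boot all_order all_algebra all_fingroup.
From mathcomp Require Import boolp classical_sets functions reals topology normedtype derive.
From mathcomp Require Import Rstruct Rstruct_topology ring lra zify.
From mathcomp Require exp.
Require Import Defs.

(**
Place the points on two vertical lines at distance [B], the first indices on the left line
and the remaining ones on the right line, so that an edge between the lines has length at
most [B] only if it is horizontal.  A pyramidal tour crosses twice between the lines.  One
horizontal bridge is provided, hence a tour exists exactly if one of [k] free points on the
right line is level with a fixed point on the left line, at an integer height.  Letting the
free heights range over pairwise disjoint unit cubes with integer vertices, one for each
permutation of [k] elements, the no-instances are the interiors of these [k!] cubes.

The inputs rejected by a tree of depth [h] form a union of [3 ^ h] projections of zero sets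
of nonnegative polynomials of degree 8 in [k + 2h] variables, every node introducing at most
two variables.  If the zeros of such an [F] project into several cubes, then [F] vanishes
somewhere above each of them and nowhere above their walls, so [M F + \sum_i w_i ^ 10] has
for large [M] a critical point above the interior of each of these cubes.  At a critical point
[w_i ^ 9] equals a polynomial of degree less than 9, so that all functions on a finite set of
critical points are combinations of the [9 ^ (k + 2h)] monomials with exponents less than 9;
this bounds the number of cubes.  Hence [k! <= 3 ^ h * 9 ^ (k + 2h)].
*)

Set Implicit Arguments.
Unset Strict Implicit.
Unset Printing Implicit Defensive.
Import Order.TTheory GRing.Theory Num.Theory.
Import numFieldNormedType.Exports.
Local Open Scope ring_scope.

(** * Polynomial functions *)

(* The variables of a polynomial are the first [m] terms of a sequence, so that introducing a
   new variable requires no cast. *)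
Inductive polyfun (R : comNzRingType) (m : nat) : nat -> ((nat -> R) -> R) -> Prop :=
| polyfun_cst d c : polyfun m d (fun=> c)
| polyfun_var d i : (i < m)%N -> polyfun m d.+1 (fun w => w i)
| polyfun_add d f g : polyfun m d f -> polyfun m d g -> polyfun m d (fun w => f w + g w)
| polyfun_mul d e f g : polyfun m d f -> polyfun m e g -> polyfun m (d + e) (fun w => f w * g w).

Definition agree (R : Type) (m : nat) (w w' : nat -> R) : Prop :=
  forall i, (i < m)%N -> w i = w' i.

Definition monomial (R : comNzRingType) m (a : 'I_m -> nat) (w : nat -> R) : R :=
  \prod_(i < m) w i ^+ a i.

Definition mdeg m (a : 'I_m -> nat) : nat := (\sum_(i < m) a i)%N.

Section PolynomialFunctions.
Context (R : comNzRingType).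
Implicit Types (m d e : nat) (f g : (nat -> R) -> R) (w : nat -> R).

Lemma eq_polyfun m d f g : f =1 g -> polyfun m d f -> polyfun m d g.
Proof. by move=> /funext->. Qed.

Lemma polyfun_leq m m' d d' f :
  (m <= m')%N -> (d <= d')%N -> polyfun m d f -> polyfun m' d' f.
Proof.
move=> mm' dd' pf; elim: pf d' dd' => {d f}.
- by move=> d c d' _; apply: polyfun_cst.
- by move=> d i im [//|d'] _; apply: polyfun_var; apply: leq_trans mm'.
- by move=> d f g _ IHf _ IHg d' dd'; apply: polyfun_add; [exact: IHf|exact: IHg].
- move=> d e f g _ IHf _ IHg d' dd'.
  by rewrite (_ : d' = d + (d' - d))%N; [apply: polyfun_mul; [exact: IHf|apply: IHg]|]; lia.
Qed.

Lemma polyfun_agree m d f w w' : polyfun m d f -> agree m w w' -> f w = f w'.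
Proof.
move=> pf ww'; elim: pf => {d f} //.
- by move=> d f g _ -> _ ->.
- by move=> d e f g _ -> _ ->.
Qed.

Lemma polyfun0_cst m f : polyfun m 0 f -> exists c, f = fun=> c.
Proof.
move dE: 0%N => d pf; elim: pf dE => {d f}.
- by move=> d c _; exists c.
- by [].
- move=> d f g _ IHf _ IHg d0.
  by have [[a ->] [b ->]] := (IHf d0, IHg d0); exists (a + b).
- move=> d e f g _ IHf _ IHg /esym/eqP; rewrite addn_eq0 => /andP[/eqP d0 /eqP e0].
  by have [[a ->] [b ->]] := (IHf (esym d0), IHg (esym e0)); exists (a * b).
Qed.

Lemma polyfun_scale m d c f : polyfun m d f -> polyfun m d (fun w => c * f w).
Proof. exact: (polyfun_mul (polyfun_cst m 0 c)). Qed.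

Lemma polyfun_sub m d f g : polyfun m d f -> polyfun m d g -> polyfun m d (fun w => f w - g w).
Proof.
move=> pf /(polyfun_scale (-1)) pg.
by apply: eq_polyfun (polyfun_add pf pg) => w; rewrite mulN1r.
Qed.

Lemma polyfun_sum m d (I : Type) (s : seq I) (f : I -> (nat -> R) -> R) :
  (forall i, polyfun m d (f i)) -> polyfun m d (fun w => \sum_(i <- s) f i w).
Proof.
move=> pf; elim: s => [|i s IHs].
  by apply: eq_polyfun (polyfun_cst m d 0) => w; rewrite big_nil.
by apply: eq_polyfun (polyfun_add (pf i) IHs) => w; rewrite big_cons.
Qed.

Lemma polyfun_prod m (I : Type) (s : seq I) (P : pred I) (d : I -> nat)
    (f : I -> (nat -> R) -> R) :
  (forall i, P i -> polyfun m (d i) (f i)) ->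
  polyfun m (\sum_(i <- s | P i) d i) (fun w => \prod_(i <- s | P i) f i w).
Proof.
move=> pf; elim: s => [|i s IHs].
  by rewrite big_nil; apply: eq_polyfun (polyfun_cst m 0 1) => w; rewrite big_nil.
rewrite big_cons; case: ifP => Pi.
  by apply: eq_polyfun (polyfun_mul (pf i Pi) IHs) => w; rewrite big_cons Pi.
by apply: eq_polyfun IHs => w; rewrite big_cons Pi.
Qed.

Lemma polyfun_sqr m d f : polyfun m d f -> polyfun m d.*2 (fun w => f w ^+ 2).
Proof.
by move=> pf; rewrite -addnn; apply: eq_polyfun (polyfun_mul pf pf) => w; rewrite expr2.
Qed.

Lemma polyfun_varX m i k : (i < m)%N -> polyfun m k (fun w => w i ^+ k).
Proof.
move=> im; elim: k => [|k IHk]; first exact: polyfun_cst.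
by apply: eq_polyfun (polyfun_mul (polyfun_var _ 0 im) IHk) => w; rewrite exprS.
Qed.

Lemma polyfun_monomial m (a : 'I_m -> nat) : polyfun m (mdeg a) (@monomial R m a).
Proof. by apply: polyfun_prod => i _; apply: polyfun_varX. Qed.

Lemma monomialD m (a b : 'I_m -> nat) w :
  monomial (fun i => a i + b i)%N w = monomial a w * monomial b w.
Proof. by rewrite /monomial -big_split; apply: eq_bigr => i _; rewrite exprD. Qed.

Lemma monomial_varX m (i : 'I_m) k w :
  monomial (fun j => (j == i) * k)%N w = w i ^+ k.
Proof.
rewrite /monomial (bigD1 i) //= eqxx mul1n big1 ?mulr1 // => j /negbTE->.
by rewrite mul0n expr0.
Qed.

Lemma mdegD m (a b : 'I_m -> nat) : mdeg (fun i => a i + b i)%N = (mdeg a + mdeg b)%N.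
Proof. exact: big_split. Qed.

Lemma mdeg_varX m (i : 'I_m) k : mdeg (fun j => (j == i) * k)%N = k.
Proof.
by rewrite /mdeg (bigD1 i) //= eqxx mul1n big1 ?addn0 // => j /negbTE->; rewrite mul0n.
Qed.

Lemma polyfun_monomial_ind m d f (V : ((nat -> R) -> R) -> Prop) :
  V (fun=> 0) ->
  (forall c f g, V f -> V g -> V (fun w => c * f w + g w)) ->
  (forall a : 'I_m -> nat, (mdeg a <= d)%N -> V (monomial a)) ->
  polyfun m d f -> V f.
Proof.
move=> V0 Vlin Vmon pf; elim: pf V V0 Vlin Vmon => {d f}.
- move=> d c V V0 Vlin Vmon.
  have -> : (fun=> c) = (fun w : nat -> R => c * monomial (fun i : 'I_m => 0)%N w + 0).
    by apply: funext => w; rewrite /monomial big1 ?mulr1 ?addr0.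
  by apply: Vlin => //; apply: Vmon; rewrite /mdeg big1.
- move=> d i im V V0 Vlin Vmon.
  have -> : (fun w : nat -> R => w i) = monomial (fun j => (j == Ordinal im) * 1)%N.
    by apply: funext => w; rewrite monomial_varX expr1.
  by apply: Vmon; rewrite mdeg_varX.
- move=> d f g _ IHf _ IHg V V0 Vlin Vmon.
  have -> : (fun w => f w + g w) = (fun w => 1 * f w + g w).
    by apply: funext => w; rewrite mul1r.
  exact: Vlin (IHf V V0 Vlin Vmon) (IHg V V0 Vlin Vmon).
- move=> d e f g _ IHf _ IHg V V0 Vlin Vmon.
  apply: (IHf (fun f => V (fun w => f w * g w))) => [|c f1 f2 Vf1 Vf2|a ad].
  + by rewrite (_ : (fun w => _) = (fun=> 0)) //; apply: funext => w; rewrite mul0r.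
  + rewrite (_ : (fun w => _) = (fun w => c * (f1 w * g w) + f2 w * g w)).
      exact: Vlin Vf1 Vf2.
    by apply: funext => w; ring.
  apply: (IHg (fun g => V (fun w => monomial a w * g w))) => [|c g1 g2 Vg1 Vg2|b be].
  + by rewrite (_ : (fun w => _) = (fun=> 0)) //; apply: funext => w; rewrite mulr0.
  + rewrite (_ : (fun w => _) = (fun w => c * (monomial a w * g1 w) + monomial a w * g2 w)).
      exact: Vlin Vg1 Vg2.
    by apply: funext => w; ring.
  under eq_fun do rewrite -monomialD.
  by apply: Vmon; rewrite mdegD leq_add.
Qed.

End PolynomialFunctions.

(** * Counting points with polynomial equations *)

Section SeparatedPoints.
Context (F : fieldType) (m : nat) (I : finType) (p : I -> nat -> F).

Lemma polyfun_interpolation : (forall a b, agree m (p a) (p b) -> a = b) ->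
  forall a, exists f, (exists d, polyfun m d f) /\ forall b, f (p b) = (b == a)%:R.
Proof.
move=> p_inj a.
have /choice[l lP] : forall b, exists l, b != a -> (l < m)%N /\ p a l != p b l.
  move=> b; apply: contrapT => /forallNP noL.
  suff ba : b = a by apply: (noL 0%N); rewrite ba eqxx.
  symmetry; apply: p_inj => l lm; apply: contrapT => /eqP pl.
  by apply: (noL l).
pose f w := \prod_(b | b != a) ((p a (l b) - p b (l b))^-1 * (w (l b) - p b (l b))).
exists f; split.
  exists (\sum_(b | b != a) 1)%N; apply: polyfun_prod => b /lP[lm _].
  apply/polyfun_scale/polyfun_sub; [exact: polyfun_var|exact: polyfun_cst].
move=> b; have [->|ba] := eqVneq b a.
  by rewrite /f big1 // => c /lP[_ pl]; rewrite mulVf // subr_eq0.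
by rewrite /f (bigD1 b) //= subrr mulr0 mul0r.
Qed.

Context (e : nat) (r : nat -> (nat -> F) -> F).
Hypothesis e_gt0 : (0 < e)%N.
Hypothesis polyfun_r : forall i, (i < m)%N -> polyfun m e.-1 (r i).
Hypothesis p_reduce : forall i a, (i < m)%N -> p a i ^+ e = r i (p a).

Let at_points (f : (nat -> F) -> F) : {ffun I -> F^o} := [ffun a => f (p a)].

Let reduced_monomials : seq {ffun I -> F^o} :=
  [seq at_points (monomial (fun i => a i : nat)) | a : {ffun 'I_m -> 'I_e}].

Lemma span_reduced_monomials d f : polyfun m d f -> at_points f \in <<reduced_monomials>>%VS.
Proof.
elim/ltn_ind: d f => d IHd f.
apply: (polyfun_monomial_ind (V := fun f => at_points f \in _)) => [|c {}f g Vf Vg|a ad].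
- by rewrite (_ : at_points _ = 0) ?mem0v //; apply/ffunP => a; rewrite !ffunE.
- rewrite (_ : at_points _ = c *: at_points f + at_points g) ?memvD ?memvZ //.
  by apply/ffunP => a; rewrite !ffunE.
have [/forallP a_lt_e|/forallPn[i]] := boolP [forall i, a i < e]%N.
  apply/memv_span/mapP; exists [ffun i => Ordinal (a_lt_e i)]; rewrite ?mem_enum //.
  by apply/ffunP => b; rewrite !ffunE; apply: eq_bigr => i _; rewrite ffunE.
rewrite -leqNgt => e_le; pose b j := (a j - (j == i) * e)%N.
have aE : a = (fun j => (j == i) * e + b j)%N.
  by apply: funext => j; rewrite subnKC //; case: eqP => [->|_]; rewrite ?mul1n ?mul0n.
have -> : at_points (monomial a) = at_points (fun w => r i w * monomial b w).
  by apply/ffunP => c; rewrite !ffunE aE monomialD monomial_varX p_reduce.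
apply: (IHd (e.-1 + mdeg b)%N).
  by move: ad; rewrite aE mdegD mdeg_varX; lia.
by apply: polyfun_mul; [exact: polyfun_r|exact: polyfun_monomial].
Qed.

Lemma card_reduced_points : (forall a b, agree m (p a) (p b) -> a = b) -> (#|I| <= e ^ m)%N.
Proof.
move=> p_inj.
have span_full : (fullv <= <<reduced_monomials>>)%VS.
  apply/subvP => g _.
  have /choice[f fP] := polyfun_interpolation p_inj.
  rewrite (_ : g = \sum_a g a *: at_points (f a)).
    apply: memv_suml => a _; apply/memvZ.
    by have [[d /span_reduced_monomials]] := fP a.
  apply/ffunP => b; rewrite sum_ffunE (bigD1 b) //= big1 ?addr0 => [|a ab].
    by rewrite !ffunE (fP b).2 eqxx [_ *: _]mulr1.
  by rewrite !ffunE (fP a).2 eq_sym (negbTE ab) scaler0.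
have -> : #|I| = \dim (fullv : {vspace {ffun I -> F^o}}) by rewrite dimvf /dim /= muln1.
apply: leq_trans (dimvS span_full) (leq_trans (dim_span _) _).
by rewrite size_image card_ffun !card_ord.
Qed.

End SeparatedPoints.

(** * Critical points in boxes *)

Section Update.
Context (T : Type).
Implicit Types (w : nat -> T) (i m : nat) (s t : T).

Definition upd w i t : nat -> T := [eta w with i |-> t].

Lemma upd_in w i t : upd w i t i = t.
Proof. by rewrite /upd /= eqxx. Qed.

Lemma upd_id w i : upd w i (w i) = w.
Proof. by apply: funext => j; rewrite /upd /=; case: eqP => // ->. Qed.

Lemma agree_upd m w i t : (m <= i)%N -> agree m (upd w i t) w.
Proof. by move=> mi j jm; rewrite /upd /= ltn_eqF // (leq_trans jm). Qed.

Lemma agree_upd_last m w w' : agree m w w' -> agree m.+1 (upd w m (w' m)) w'.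
Proof.
move=> ww' i; rewrite ltnS leq_eqVlt /upd /= => /orP[/eqP->|im]; first by rewrite eqxx.
by rewrite ltn_eqF // ww'.
Qed.

End Update.

Section Box.
Context (R : numDomainType) (k : nat) (lo hi : nat -> R).

Definition box : set (nat -> R) := [set w | forall i, (i < k)%N -> lo i <= w i <= hi i].

Definition box_interior : set (nat -> R) :=
  [set w | forall i, (i < k)%N -> lo i < w i < hi i].

Definition box_wall : set (nat -> R) :=
  [set w | box w /\ exists2 i, (i < k)%N & w i = lo i \/ w i = hi i].

Lemma box_interior_sub w : box_interior w -> box w.
Proof. by move=> wi i /wi/andP[? ?]; rewrite !ltW. Qed.

Lemma box_interiorP w : box w -> ~ box_wall w -> box_interior w.
Proof.
move=> wb wnw i ik; have /andP[lo_w w_hi] := wb i ik.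
rewrite !lt_neqAle lo_w w_hi !andbT; apply/andP.
by split; apply/eqP => wE; apply: wnw; split=> //; exists i => //; [left|right].
Qed.

End Box.

Definition partial (R : realType) (i : nat) (f : (nat -> R) -> R) (w : nat -> R) : R :=
  derive1 (fun t => f (upd w i t)) (w i).

Definition critical (R : realType) (m : nat) (f : (nat -> R) -> R) (w : nat -> R) : Prop :=
  forall i, (i < m)%N -> partial i f w = 0.

Definition power_sum (R : comNzRingType) (m n : nat) (w : nat -> R) : R := \sum_(i < m) w i ^+ n.

Section CriticalPoints.
Context (R : realType).
Implicit Types (m d k i : nat) (f g : (nat -> R) -> R) (w z lo hi : nat -> R).

Lemma polyfun_derivable m d f i w t :
  polyfun m d f -> derivable (fun t => f (upd w i t)) t 1.
Proof.
elim=> {d f} [d c|d j _|d f g _ df _ dg|d e f g _ df _ dg].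
- exact: derivable_cst.
- by rewrite /upd /=; case: (j == i); [exact: derivable_id|exact: derivable_cst].
- exact: derivableD.
- exact: derivableM.
Qed.

Lemma partialD m d f g i w : polyfun m d f -> polyfun m d g ->
  partial i (fun w => f w + g w) w = partial i f w + partial i g w.
Proof.
move=> pf pg; rewrite /partial !derive1E.
exact: deriveD (polyfun_derivable pf) (polyfun_derivable pg).
Qed.

Lemma partialM m d e f g i w : polyfun m d f -> polyfun m e g ->
  partial i (fun w => f w * g w) w = f w * partial i g w + g w * partial i f w.
Proof.
move=> pf pg; rewrite /partial !derive1E.
by rewrite (deriveM (polyfun_derivable pf) (polyfun_derivable pg)) upd_id.
Qed.

Lemma partial_cst c i w : partial i (fun=> c) w = 0.
Proof. by rewrite /partial derive1E derive_cst. Qed.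

Lemma partialZ m d c f i w : polyfun m d f ->
  partial i (fun w => c * f w) w = c * partial i f w.
Proof. by move=> pf; rewrite (partialM _ _ (polyfun_cst m 0 c) pf) partial_cst mulr0 addr0. Qed.

Lemma partial_power_sum m n i w : (i < m)%N ->
  partial i (power_sum m n) w = n%:R * w i ^+ n.-1.
Proof.
move=> im; pose c := \sum_(j < m | j != Ordinal im) w j ^+ n.
rewrite /partial (_ : (fun t => _) = (id ^+ n) \+ cst c); last first.
  apply: funext => t; rewrite /power_sum (bigD1 (Ordinal im)) //= upd_in fctE.
  congr (_ + _); apply: eq_bigr => j; rewrite -val_eqE /upd /= => /negbTE ji.
  by rewrite ji.
rewrite derive1E deriveD; last 2 first.
- exact/derivableX/derivable_id.
- exact: derivable_cst.
by rewrite deriveX; [rewrite derive_id derive_cst addr0 [_ *: _]mulr1|exact: derivable_id].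
Qed.

Lemma polyfun_power_sum m n : polyfun m n (@power_sum R m n).
Proof. by apply: polyfun_sum => i; apply: polyfun_varX. Qed.

Lemma polyfun_partial m d f i : polyfun m d f -> polyfun m d.-1 (partial i f).
Proof.
elim=> {d f} [d c|d j _|d f g pf pf' pg pg'|d e f g pf pf' pg pg'].
- by apply: eq_polyfun (polyfun_cst m _ 0) => w; rewrite partial_cst.
- apply: eq_polyfun (polyfun_cst m _ (j == i)%:R) => w.
  rewrite /partial derive1E /upd /=; case: (j == i); first by rewrite derive_id.
  by rewrite derive_cst.
- by apply: eq_polyfun (polyfun_add pf' pg') => w; rewrite (partialD _ _ pf pg).
case: d pf pf' => [/polyfun0_cst[c ->] _|d pf pf'].
  by apply: eq_polyfun (polyfun_scale c pg') => w; rewrite (partialZ _ _ _ pg).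
case: e pg pg' => [/polyfun0_cst[c ->] _|e pg pg'].
  rewrite addn0; apply: eq_polyfun (polyfun_scale c pf') => w.
  by under [in RHS]eq_fun do rewrite mulrC; rewrite (partialZ _ _ _ pf).
apply: (@eq_polyfun _ _ _ (fun w => f w * partial i g w + g w * partial i f w)) => [w|].
  by rewrite (partialM _ _ pf pg).
apply: polyfun_add; first by rewrite addnS; apply: polyfun_mul.
by rewrite addSn /= addnC; apply: polyfun_mul.
Qed.

Lemma card_critical_points m e f (I : finType) (p : I -> nat -> R) :
  (0 < e)%N -> polyfun m e f ->
  (forall a b, agree m (p a) (p b) -> a = b) ->
  (forall a, critical m (fun w => f w + power_sum m e.+1 w) (p a)) ->
  (#|I| <= e ^ m)%N.
Proof.
move=> e_gt0 pf p_inj crit.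
pose r i w := - e.+1%:R^-1 * partial i f w.
apply: (card_reduced_points (p := p) (r := r)) => // [i im|i a im].
  exact/polyfun_scale/polyfun_partial.
have := crit a i im.
rewrite (partialD _ _ (polyfun_leq (leqnn m) (leqnSn e) pf) (polyfun_power_sum m e.+1)).
rewrite partial_power_sum // => /eqP; rewrite addrC addr_eq0 => /eqP criticalE.
by rewrite /r mulNr -mulrN -criticalE mulKf // pnatr_eq0.
Qed.

Lemma critical_box_min m d f z lo hi : polyfun m d f -> box_interior m lo hi z ->
  (forall w, box m lo hi w -> f z <= f w) -> critical m f z.
Proof.
move=> pf zb minz i im; have /andP[loz zhi] := zb i im.
rewrite /partial derive1E.
apply: (@derive_val _ _ _ _ _ _ _ (@derive1_at_min _ _ (lo i) (hi i) _ _ _ _ _)).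
- exact/ltW/(lt_trans loz).
- by move=> t _; apply: polyfun_derivable pf.
- by rewrite in_itv /= loz.
- move=> t; rewrite in_itv /= => /andP[lot thi]; rewrite upd_id; apply: minz => j jm.
  rewrite /upd /=; case: eqP => [->|_]; first by rewrite !ltW.
  exact: box_interior_sub zb _ jm.
Qed.

Definition row_seq m (v : 'rV[R]_m) (i : nat) : R := oapp (v ord0) 0 (insub i).

Lemma row_seqE m (v : 'rV[R]_m) (i : 'I_m) : row_seq v i = v ord0 i.
Proof. by rewrite /row_seq valK. Qed.

Lemma polyfun_continuous m d f :
  polyfun m d f -> continuous (fun v : 'rV[R]_m => f (row_seq v)).
Proof.
elim=> {d f} [d c|d i im|d f g _ cf _ cg v|d e f g _ cf _ cg v].
- exact: cst_continuous.
- under eq_fun do rewrite (row_seqE _ (Ordinal im)).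
  exact: coord_continuous.
- exact: (continuousD (cf v) (cg v)).
- exact: (continuousM (cf v) (cg v)).
Qed.

Lemma polyfun_box_min m d f lo hi : polyfun m d f -> (box m lo hi !=set0)%classic ->
  exists2 z, box m lo hi z & forall w, box m lo hi w -> f z <= f w.
Proof.
move=> pf [w0 w0b].
pose A := [set v : 'rV[R]_m | forall i : 'I_m, `[lo i, hi i]%classic (v ord0 i)]%classic.
have cA : compact A.
  by apply: (@rV_compact R m (fun i : 'I_m => `[lo i, hi i]%classic)) => i; exact: segment_compact.
have A_row w : box m lo hi w -> A (\row_(i < m) w i).
  by move=> wb i /=; rewrite mxE in_itv /= wb.
have cf : {within A, continuous (fun v : 'rV[R]_m => f (row_seq v))}%classic.
  by apply: continuous_subspaceT => v; apply: (polyfun_continuous pf).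
have [c /set_mem Ac minc] := EVT_min_rV (ex_intro _ _ (A_row _ w0b)) cA cf.
exists (row_seq c) => [i im|w wb].
  by have := Ac (Ordinal im); rewrite /= in_itv /= -row_seqE.
have w_row : agree m w (row_seq (\row_(i < m) w i)).
  by move=> i im; rewrite (row_seqE _ (Ordinal im)) mxE.
by rewrite (polyfun_agree pf w_row); apply/minc/mem_set/A_row.
Qed.

Lemma near_gt_on_face m d f lo hi j x c : polyfun m d f -> (j < m)%N ->
  (forall w, box m lo hi w -> w j = x -> 0 < f w) ->
  \forall M \near +oo, forall w, box m lo hi w -> w j = x -> c < M * f w.
Proof.
move=> pf jm f_gt0.
have [[w0 [w0b w0x]]|no_face] := pselect (exists w, box m lo hi w /\ w j = x); last first.
  by near=> M => w wb wx; case: no_face; exists w.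
have box_face w : box m (upd lo j x) (upd hi j x) w <-> box m lo hi w /\ w j = x.
  split=> [wb|[wb wx] i im]; last first.
    by rewrite /upd /=; case: eqP => [->|_]; [rewrite wx lexx|exact: wb].
  have wx : w j = x by apply/le_anti; have := wb j jm; rewrite !upd_in andbC.
  split=> // i im; have := wb i im; rewrite /upd /=; case: eqP => // -> _.
  by rewrite wx -w0x; apply: w0b.
have [|z /box_face[zb zx] minz] := polyfun_box_min (lo := upd lo j x) (hi := upd hi j x) pf.
  by exists w0; apply/box_face.
have fz : 0 < f z by apply: f_gt0.
near=> M => w wb wx.
have M_ge0 : 0 <= M by near: M; apply: nbhs_pinfty_ge; exact: num_real.
apply: (@lt_le_trans _ _ (M * f z)); last by rewrite ler_wpM2l // minz //; apply/box_face.
by rewrite -ltr_pdivrMr //; near: M; apply: nbhs_pinfty_gt; exact: num_real.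
Unshelve. all: end_near. Qed.

Lemma near_gt_on_wall m k d f lo hi lo' hi' c : polyfun m d f -> (k <= m)%N ->
  (box m lo' hi' `<=` box k lo hi)%classic ->
  (forall w, box_wall k lo hi w -> 0 < f w) ->
  \forall M \near +oo, forall w, box m lo' hi' w -> box_wall k lo hi w -> c < M * f w.
Proof.
move=> pf km box_sub wall.
have : \forall M \near +oo, forall j : 'I_k, forall b : bool, forall w, box m lo' hi' w ->
    w j = (if b then lo j else hi j) -> c < M * f w.
  apply: filter_forall => j; apply: filter_forall => b.
  apply: near_gt_on_face pf (leq_trans (ltn_ord j) km) _ => w /box_sub wb wj.
  apply: wall; split=> //; exists (val j); first exact: ltn_ord.
  by case: b wj => wj; [left|right].
apply: filterS => M M_faces w wb [_ [j jk [wj|wj]]].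
  exact: (M_faces (Ordinal jk) true).
exact: (M_faces (Ordinal jk) false).
Qed.

Lemma power_sum_ge0 m n w : ~~ odd n -> 0 <= power_sum m n w.
Proof. by move=> n_even; apply: sumr_ge0 => i _; rewrite exprn_even_ge0. Qed.

Lemma power_sum_sublevel_bounded m n c : (0 < n)%N -> ~~ odd n ->
  exists rho, forall w, power_sum m n w <= c -> forall i, (i < m)%N -> `|w i| < rho.
Proof.
move=> n_gt0 n_even; exists (1 + `|c|) => w wc i im.
have rho_ge1 : 1 <= 1 + `|c| by rewrite lerDl.
rewrite ltNge; apply: contraL wc => rho_le; rewrite -ltNge.
apply: (@lt_le_trans _ _ ((1 + `|c|) ^+ n)).
  rewrite (@lt_le_trans _ _ (1 + `|c|)) ?ler_eXnr //.
  by rewrite (le_lt_trans (ler_norm c)) // ltrDr.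
apply: (@le_trans _ _ (`|w i| ^+ n)).
  by rewrite lerXn2r ?nnegrE ?normr_ge0 ?(le_trans ler01).
rewrite -normrX ger0_norm ?exprn_even_ge0 // /power_sum (bigD1 (Ordinal im)) //=.
by rewrite lerDl sumr_ge0 // => j _; rewrite exprn_even_ge0.
Qed.

(* The power sum confines the variables from [k] on, and for large [M] the term [M * f]
   keeps a minimizer off the walls. *)
Lemma near_critical_in_box m k d n f w0 lo hi : polyfun m d f -> (forall w, 0 <= f w) ->
  (k <= m)%N -> (0 < n)%N -> ~~ odd n ->
  box k lo hi w0 -> f w0 = 0 -> (forall w, box_wall k lo hi w -> f w != 0) ->
  \forall M \near +oo, exists2 z, box_interior k lo hi z &
    critical m (fun w => M * f w + power_sum m n w) z.
Proof.
move=> pf f_ge0 km n_gt0 n_even w0b fw0 wall.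
have [rho rhoP] := power_sum_sublevel_bounded m (power_sum m n w0) n_gt0 n_even.
pose lo' i := if (i < k)%N then lo i else - rho.
pose hi' i := if (i < k)%N then hi i else rho.
have w0b' : box m lo' hi' w0.
  by move=> i im; rewrite /lo' /hi'; case: ifP => [/w0b//|_]; rewrite -ler_norml ltW ?rhoP.
have box_sub : (box m lo' hi' `<=` box k lo hi)%classic.
  by move=> w wb i ik; have := wb i (leq_trans ik km); rewrite /lo' /hi' ik.
near=> M.
have M_ge0 : 0 <= M by near: M; apply: nbhs_pinfty_ge; exact: num_real.
have M_wall : forall w, box m lo' hi' w -> box_wall k lo hi w -> power_sum m n w0 < M * f w.
  near: M; apply: near_gt_on_wall pf km box_sub _ => w /wall.
  by rewrite lt_neqAle f_ge0 andbT eq_sym.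
have pg : polyfun m (maxn d n) (fun w => M * f w + power_sum m n w).
  apply: polyfun_add; first exact/polyfun_scale/(polyfun_leq _ _ pf)/leq_maxl.
  exact/(polyfun_leq _ _ (polyfun_power_sum m n))/leq_maxr.
have [z zb minz] := polyfun_box_min pg (ex_intro _ w0 w0b').
have z_le : M * f z + power_sum m n z <= power_sum m n w0.
  by apply: le_trans (minz _ w0b') _; rewrite fw0 mulr0 add0r.
have z_int : box_interior k lo hi z.
  apply: (box_interiorP (box_sub _ zb)) => /(M_wall _ zb); apply/negP; rewrite -leNgt.
  by apply: le_trans z_le; rewrite lerDl power_sum_ge0.
exists z => //; apply: critical_box_min pg _ minz => i im; rewrite /lo' /hi'.
case: ifP => [/z_int//|_]; rewrite -ltr_norml; apply: rhoP im.
by apply: le_trans z_le; rewrite lerDr mulr_ge0.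
Unshelve. all: end_near. Qed.

(* A substitute for the Milnor-Thom bound on the number of connected components. *)
Lemma card_boxes_with_zeros m k e f (I : finType) (lo hi : I -> nat -> R) :
  odd e -> polyfun m e f -> (forall w, 0 <= f w) -> (k <= m)%N ->
  trivIset setT (fun a => box k (lo a) (hi a)) ->
  (forall a, exists2 w, box k (lo a) (hi a) w & f w = 0) ->
  (forall a w, box_wall k (lo a) (hi a) w -> f w != 0) ->
  (#|I| <= e ^ m)%N.
Proof.
move=> e_odd pf f_ge0 km disj zero wall.
have /filter_ex[M /choice[z zP]] : \forall M \near +oo, forall a, exists z,
    box_interior k (lo a) (hi a) z /\
    critical m (fun w => M * f w + power_sum m e.+1 w) z.
  apply: filter_forall => a; have [w0 w0b fw0] := zero a.
  have : \forall M \near +oo, exists2 z, box_interior k (lo a) (hi a) z &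
      critical m (fun w => M * f w + power_sum m e.+1 w) z.
    by apply: near_critical_in_box pf _ _ _ _ w0b fw0 (wall a); rewrite //= negbK.
  by apply: filterS => M [z]; exists z.
apply: (card_critical_points (p := z) (f := fun w => M * f w)).
- exact: odd_gt0.
- exact: polyfun_scale.
- move=> a b zab; apply: disj => //; exists (z a); split.
    exact: box_interior_sub (zP a).1.
  by move=> i ik; rewrite (zab i (leq_trans ik km)); apply: box_interior_sub (zP b).1 _ ik.
- by move=> a; have [] := zP a.
Qed.

End CriticalPoints.

(** * Projections of zero sets *)

Definition zero_projections (R : rcfType) (e m M N : nat) (X : set (nat -> R)) : Prop :=
  exists (J : finType) (f : J -> (nat -> R) -> R),
    [/\ (#|J| <= N)%N, forall j, polyfun M e (f j), forall j w, 0 <= f j w &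
        forall w, X w <-> exists j w', agree m w w' /\ f j w' = 0].

Section ZeroProjections.
Local Open Scope classical_set_scope.
Context (R : rcfType) (e : nat).
Implicit Types (m M N d : nat) (f : (nat -> R) -> R) (X Y Z : set (nat -> R)) (w : nat -> R).

Lemma eq_zero_projections m M N X Y : (forall w, X w <-> Y w) ->
  zero_projections e m M N X -> zero_projections e m M N Y.
Proof. by move=> XY; rewrite (_ : X = Y) //; apply/seteqP; split=> w /XY. Qed.

Lemma zero_projections_leq e' m M M' N N' X : (e <= e')%N -> (M <= M')%N -> (N <= N')%N ->
  zero_projections e m M N X -> zero_projections e' m M' N' X.
Proof.
move=> ee' MM' NN' [J [f [JN pf f_ge0 fX]]]; exists J, f; split=> // [|j].
  exact: leq_trans NN'.
exact: polyfun_leq (pf j).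
Qed.

Lemma zero_projections0 m M : @zero_projections R e m M 0 set0.
Proof.
exists void, (fun=> fun=> 0); rewrite card_void; split=> // w.
by split=> // -[[]].
Qed.

Lemma zero_projectionsT m M : @zero_projections R e m M 1 setT.
Proof.
exists unit, (fun=> fun=> 0); rewrite card_unit; split=> // [_|w]; first exact: polyfun_cst.
by split=> // _; exists tt, w.
Qed.

Lemma zero_projectionsU m M N N' X Y : zero_projections e m M N X ->
  zero_projections e m M N' Y -> zero_projections e m M (N + N') (X `|` Y).
Proof.
move=> [J [f [JN pf f_ge0 fX]]] [J' [f' [JN' pf' f'_ge0 f'Y]]].
exists (J + J')%type, (fun j => match j with inl j => f j | inr j => f' j end).
split=> [|[]|[]|w] //; first by rewrite card_sum leq_add.
split=> [[/fX[j [w' fw']]|/f'Y[j [w' fw']]]|[[j|j] [w' fw']]].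
- by exists (inl j), w'.
- by exists (inr j), w'.
- by left; apply/fX; exists j, w'.
- by right; apply/f'Y; exists j, w'.
Qed.

Lemma zero_projections_eq0 m M N d f X : (m <= M)%N -> (d.*2 <= e)%N -> polyfun m d f ->
  zero_projections e m M N X -> zero_projections e m M N [set w | f w = 0 /\ X w].
Proof.
move=> mM de pf [J [g [JN pg g_ge0 gX]]]; exists J, (fun j w => f w ^+ 2 + g j w).
split=> // [j|j w|w].
- by apply: polyfun_add => //; apply: polyfun_leq (polyfun_sqr pf).
- by rewrite addr_ge0 ?sqr_ge0.
split=> [[fw /gX[j [w' [ww' gw']]]]|[j [w' [ww' /eqP]]]].
  by exists j, w'; rewrite -(polyfun_agree pf ww') fw gw' expr0n addr0.
rewrite paddr_eq0 ?sqr_ge0 // sqrf_eq0 -(polyfun_agree pf ww') => /andP[/eqP fw /eqP gw'].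
by split=> //; apply/gX; exists j, w'.
Qed.

Lemma zero_projections_exists m M N X : zero_projections e m.+1 M N X ->
  zero_projections e m M N [set w | exists t, X (upd w m t)].
Proof.
move=> [J [f [JN pf f_ge0 fX]]]; exists J, f; split=> // w.
split=> [[t /fX[j [w' [ww' fw']]]]|[j [w' [ww' fw']]]].
  exists j, w'; split=> // i im; rewrite -(agree_upd w t (leqnn m) im).
  exact/ww'/ltnW.
by exists (w' m); apply/fX; exists j, w'; split=> //; apply: agree_upd_last.
Qed.

(* [f w < 0] amounts to the solvability of [f w * t ^+ 2 + 1 = 0] in [t]. *)
Lemma zero_projections_lt0 m M N d f X : (m < M)%N -> (d.+2.*2 <= e)%N -> polyfun m d f ->
  (forall w t, X (upd w m t) <-> X w) -> zero_projections e m.+1 M N X ->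
  zero_projections e m M N [set w | f w < 0 /\ X w].
Proof.
move=> mM de pf X_upd zX.
have f_upd w t : f (upd w m t) = f w by apply: polyfun_agree pf (agree_upd _ _ _).
pose g w := f w * w m ^+ 2 + 1.
have pg : polyfun m.+1 d.+2 g.
  apply: polyfun_add; last exact: polyfun_cst.
  rewrite -addn2; apply: polyfun_mul; first exact: polyfun_leq pf.
  exact: polyfun_varX.
apply: eq_zero_projections (zero_projections_exists (zero_projections_eq0 mM de pg zX)) => w.
rewrite /= /g; split=> [[t]|[fw Xw]].
  rewrite f_upd upd_in X_upd => -[/eqP]; rewrite addr_eq0 => /eqP ft Xw; split=> //.
  rewrite ltNge; apply/negP => fw; have := mulr_ge0 fw (sqr_ge0 t).
  by rewrite ft; lra.
exists (Num.sqrt (- (f w)^-1)); rewrite f_upd upd_in X_upd; split=> //.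
by rewrite sqr_sqrtr ?oppr_ge0 ?invr_le0 ?ltW // mulrN mulfV ?lt_eqF // addNr.
Qed.

Lemma zero_projections_trichotomy m M N d f X Y Z : (m < M)%N -> (d.+2.*2 <= e)%N ->
  polyfun m d f ->
  (forall w t, X (upd w m t) <-> X w) -> (forall w t, Z (upd w m t) <-> Z w) ->
  zero_projections e m.+1 M N X -> zero_projections e m M N Y ->
  zero_projections e m.+1 M N Z ->
  zero_projections e m M (3 * N)
    [set w | if f w < 0 then X w else if f w == 0 then Y w else Z w].
Proof.
move=> mM de pf X_upd Z_upd zX zY zZ.
have zX' := zero_projections_lt0 mM de pf X_upd zX.
have de' : (d.*2 <= e)%N by lia.
have zY' := zero_projections_eq0 (ltnW mM) de' pf zY.
have zZ' := zero_projections_lt0 mM de (polyfun_scale (-1) pf) Z_upd zZ.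
rewrite (_ : 3 * N = N + (N + N))%N; last by lia.
apply: eq_zero_projections (zero_projectionsU zX' (zero_projectionsU zY' zZ')) => w /=.
rewrite mulN1r oppr_lt0.
split=> [[[->]|[[->]|[fw Zw]]] //|]; first by rewrite ltxx eqxx.
  by rewrite ltNge ltW //= gt_eqF.
case: ltgtP => [fw Xw|fw Zw|fw Yw]; [by left|by right; right|by right; left].
Qed.

End ZeroProjections.

Lemma card_boxes_zero_projections (R : realType) k M e N (X : set (nat -> R)) (I : finType)
    (lo hi : I -> nat -> R) :
  odd e -> (k <= M)%N -> zero_projections e k M N X ->
  trivIset setT (fun a => box k (lo a) (hi a)) ->
  (forall a, exists2 w, box k (lo a) (hi a) w & X w) ->
  (forall a w, box_wall k (lo a) (hi a) w -> ~ X w) ->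
  (#|I| <= N * e ^ M)%N.
Proof.
move=> e_odd kM [J [f [JN pf f_ge0 fX]]] disj meet wall.
have agree_box a w w' : agree k w w' -> box k (lo a) (hi a) w -> box k (lo a) (hi a) w'.
  by move=> ww' wb i ik; rewrite -ww' //; apply: wb.
have /choice[j /choice[w0 w0P]] : forall a, exists j w, box k (lo a) (hi a) w /\ f j w = 0.
  move=> a; have [w wb /fX[j [w' [ww' fw']]]] := meet a.
  by exists j, w'; split=> //; apply: agree_box wb.
have fiber i : (#|[pred a | j a == i]| <= e ^ M)%N.
  rewrite -card_sig.
  apply: (@card_boxes_with_zeros _ M k e (f i) _ (fun a => lo (sval a)) (fun a => hi (sval a)))
    => //.
  - by move=> a b _ _ meet_ab; apply/val_inj/(disj (sval a) (sval b)).
  - by case=> a /= /eqP <-; exists (w0 a); have [] := w0P a.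
  - move=> [a ai] w aw; apply/eqP => fw; apply: (wall a w aw); apply/fX.
    by exists i, w.
rewrite -sum1_card (partition_big j predT) //=.
apply: leq_trans (_ : \sum_(i : J) e ^ M <= _)%N.
  by apply: leq_sum => i _; rewrite sum1_card; apply: fiber.
by rewrite sum_nat_const leq_mul2r JN orbT.
Qed.

(** * Computation trees *)

Definition evals (fs : seq ((nat -> R) -> R)) (w : nat -> R) : seq R := [seq f w | f <- fs].

Definition affine (m : nat) (fs : seq ((nat -> R) -> R)) : Prop :=
  forall i, polyfun m 1 (nth (fun=> R0) fs i).

Definition operand_fun (inp env : seq ((nat -> R) -> R)) (o : operand) : (nat -> R) -> R :=
  match o with
  | In i => nth (fun=> R0) inp i
  | Val j => nth (fun=> R0) env j
  | Cst c => fun=> c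
  end.

Definition rejected (T : act) (inp env : seq ((nat -> R) -> R)) : set (nat -> R) :=
  [set w | ~~ act_eval T (evals inp w) (evals env w)].

Definition rejected_after (T : act) (inp env : seq ((nat -> R) -> R)) (v : (nat -> R) -> R) :
    set (nat -> R) :=
  [set w | ~~ act_eval T (evals inp w) (rcons (evals env w) (v w))].

Definition rejection_projected (T : act) : Prop := forall m inp env,
  affine m inp -> affine m env ->
  zero_projections 8 m (m + (act_depth T).*2) (3 ^ act_depth T) (rejected T inp env).

Lemma nth_evals fs w i : nth R0 (evals fs w) i = nth (fun=> R0) fs i w.
Proof. by elim: fs i => [|f fs IHfs] [|i] /=. Qed.

Lemma operand_valE inp env o w :
  operand_val (evals inp w) (evals env w) o = operand_fun inp env o w.
Proof. by case: o => [i|j|c] /=; rewrite ?nth_evals. Qed.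

Lemma evals_agree m fs w w' : affine m fs -> agree m w w' -> evals fs w = evals fs w'.
Proof.
move=> pfs ww'; apply: (@eq_from_nth _ R0) => [|i _]; first by rewrite !size_map.
by rewrite !nth_evals; apply: polyfun_agree ww'.
Qed.

Lemma evals_rcons fs f w : evals (rcons fs f) w = rcons (evals fs w) (f w).
Proof. exact: map_rcons. Qed.

Lemma affine_leq m m' fs : (m <= m')%N -> affine m fs -> affine m' fs.
Proof. by move=> mm' pfs i; apply: polyfun_leq (pfs i). Qed.

Lemma affine_rcons m f fs : affine m fs -> polyfun m 1 f -> affine m (rcons fs f).
Proof.
move=> pfs pf i; rewrite nth_rcons; case: ifP => // _.
by case: ifP => // _; apply: polyfun_cst.
Qed.

Section NodeProjections.
Context (m : nat) (inp env : seq ((nat -> R) -> R)).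
Hypotheses (inp_affine : affine m inp) (env_affine : affine m env).

Lemma polyfun_operand o : polyfun m 1 (operand_fun inp env o).
Proof. by case: o => [i|j|c] //=; apply: polyfun_cst. Qed.

Lemma evals_upd i w t : (m <= i)%N ->
  (evals inp (upd w i t) = evals inp w) * (evals env (upd w i t) = evals env w).
Proof. by move=> mi; split; apply: (@evals_agree m) => //; apply: agree_upd. Qed.

Lemma rejected_after_upd T i t v w : (m <= i)%N ->
  rejected_after T inp env (fun=> v) (upd w i t) <-> rejected_after T inp env (fun=> v) w.
Proof. by move=> mi; rewrite /rejected_after /= !evals_upd. Qed.

Lemma rejected_rcons_var T i w t : (m <= i)%N ->
  rejected T inp (rcons env (fun w => w i)) (upd w i t) <->
  rejected_after T inp env (fun=> t) w.
Proof.
by move=> mi; rewrite /rejected /rejected_after /= evals_rcons upd_in !evals_upd.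
Qed.

Context (T : act).
Hypothesis T_projected : rejection_projected T.

Lemma rejected_after_solution_projected i (g : R -> (nat -> R) -> R) : (m <= i)%N ->
  polyfun i.+1 4 (fun w => g (w i) w) -> (forall t w s, g t (upd w i s) = g t w) ->
  zero_projections 8 i (i.+1 + (act_depth T).*2) (3 ^ act_depth T)
    [set w | exists t, g t w = 0 /\ rejected_after T inp env (fun=> t) w].
Proof.
move=> mi pg g_upd.
have env'_affine : affine i.+1 (rcons env (fun w => w i)).
  by apply: affine_rcons; [apply: affine_leq env_affine; lia|exact: polyfun_var].
have zT := T_projected (affine_leq (leqW mi) inp_affine) env'_affine.
have := zero_projections_exists (zero_projections_eq0 (leq_addr _ _) (leqnn 4.*2) pg zT).
by apply: eq_zero_projections => w /=; split=> -[t] gt; exists t;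
  move: gt; rewrite upd_in g_upd rejected_rcons_var.
Qed.

Lemma rejected_after_projected i h : (m <= i)%N -> polyfun i 4 h ->
  zero_projections 8 i (i.+1 + (act_depth T).*2) (3 ^ act_depth T)
    (rejected_after T inp env h).
Proof.
move=> mi ph.
have h_upd w t : h (upd w i t) = h w by apply: polyfun_agree ph (agree_upd _ _ _).
have zS : zero_projections 8 i (i.+1 + (act_depth T).*2) (3 ^ act_depth T)
    [set w | exists t, t - h w = 0 /\ rejected_after T inp env (fun=> t) w].
  apply: (rejected_after_solution_projected (g := fun t w => t - h w)) => // [|t w s].
    by apply: polyfun_sub; [exact: polyfun_var|exact: polyfun_leq ph].
  by rewrite h_upd.
apply: eq_zero_projections zS => w /=; split=> [[t [/eqP]]|rej].
  by rewrite subr_eq0 => /eqP->.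
by exists (h w); rewrite subrr.
Qed.

Lemma rejected_after_poly_projected h : polyfun m 4 h ->
  zero_projections 8 m (m + (act_depth T).+1.*2) (3 ^ (act_depth T).+1)
    (rejected_after T inp env h).
Proof.
move=> /(rejected_after_projected (leqnn m)); apply: zero_projections_leq => //.
  by lia.
by rewrite leq_exp2l.
Qed.

Lemma rejected_after_div_projected f g : polyfun m 1 f -> polyfun m 1 g ->
  zero_projections 8 m (m + (act_depth T).+1.*2) (3 ^ (act_depth T).+1)
    (rejected_after T inp env (fun w => f w / g w)).
Proof.
move=> pf pg.
have f_upd i w t : (m <= i)%N -> f (upd w i t) = f w.
  by move=> mi; apply: polyfun_agree pf (agree_upd _ _ mi).
have g_upd i w t : (m <= i)%N -> g (upd w i t) = g w.
  by move=> mi; apply: polyfun_agree pg (agree_upd _ _ mi).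
pose quotient : set (nat -> R) :=
  [set w | exists t, t * g w - f w = 0 /\ rejected_after T inp env (fun=> t) w]%classic.
have quotient_upd w t : quotient (upd w m t) <-> quotient w.
  by split=> -[s fg]; exists s; move: fg; rewrite f_upd // g_upd // rejected_after_upd.
have z_quotient : zero_projections 8 m.+1 (m.+2 + (act_depth T).*2) (3 ^ act_depth T) quotient.
  apply: (rejected_after_solution_projected (g := fun t w => t * g w - f w)) => // [|t w s].
    apply: polyfun_sub; last by apply: polyfun_leq pf; lia.
    apply: (@polyfun_leq _ m.+2 _ 2) => //.
    by apply: (polyfun_mul (d := 1)); [exact: polyfun_var|apply: polyfun_leq pg; lia].
  by rewrite f_upd ?g_upd.
have z_zero : zero_projections 8 m (m.+2 + (act_depth T).*2) (3 ^ act_depth T)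
    (rejected_after T inp env (fun=> 0)).
  by apply: zero_projections_leq (rejected_after_projected (leqnn m) (polyfun_cst _ _ _)); lia.
rewrite expnS (_ : m + _ = m.+2 + (act_depth T).*2)%N; last by lia.
apply: eq_zero_projections (zero_projections_trichotomy _ _ pg quotient_upd quotient_upd
  z_quotient z_zero z_quotient) => [w /=||]; [|lia|by []].
have quotientE : g w != 0 ->
    quotient w <-> rejected_after T inp env (fun w => f w / g w) w.
  move=> gw; split=> [[t [/eqP]]|rej].
    by rewrite subr_eq0 => /eqP tg; rewrite /rejected_after /= -tg mulfK.
  by exists (f w / g w); rewrite divfK // subrr.
case: ltgtP => [/lt_eqF/negbT|/gt_eqF/negbT|gw]; [exact: quotientE|exact: quotientE|].
by rewrite /rejected_after /= gw invr0 mulr0.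
Qed.

(* A nonnegative value is written as [u ^+ 4], its square root being [u ^+ 2]. *)
Lemma rejected_after_sqrt_projected f : polyfun m 1 f ->
  zero_projections 8 m (m + (act_depth T).+1.*2) (3 ^ (act_depth T).+1)
    (rejected_after T inp env (fun w => Num.sqrt (f w))).
Proof.
move=> pf.
have f_upd w t : f (upd w m t) = f w by apply: polyfun_agree pf (agree_upd _ _ _).
have z_neg : zero_projections 8 m (m.+2 + (act_depth T).*2) (3 ^ act_depth T)
    [set w | f w < 0 /\ rejected_after T inp env (fun=> 0) w].
  apply: (zero_projections_lt0 _ _ pf); [lia|by []| |].
    by move=> w t; apply: rejected_after_upd.
  exact: rejected_after_projected (leqnSn m) (polyfun_cst _ _ _).
have p_root : polyfun m.+1 4 (fun w => f w - w m ^+ 4).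
  by apply: polyfun_sub; [exact: polyfun_leq pf|exact: polyfun_varX].
have p_sqr : polyfun m.+1 4 (fun w : nat -> R => w m ^+ 2).
  by apply: polyfun_leq (polyfun_varX R 2 (ltnSn m)).
have mM : (m.+1 <= m.+2 + (act_depth T).*2)%N by lia.
have z_nonneg := zero_projections_exists (zero_projections_eq0 mM (leqnn 4.*2)
  p_root (rejected_after_projected (leqnSn m) p_sqr)).
apply: zero_projections_leq (eq_zero_projections _ (zero_projectionsU z_neg z_nonneg)).
- by [].
- by lia.
- by rewrite expnS; lia.
move=> w; split=> [[[fw]|[u [/=]]]|].
- by rewrite /rejected_after /= ler0_sqrtr ?ltW.
- rewrite f_upd upd_in => /eqP; rewrite subr_eq0 /rejected_after /= !evals_upd // => /eqP->.
  by rewrite upd_in (exprM _ 2 2) sqrtr_sqr ger0_norm ?sqr_ge0.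
have [fw|fw] := ltP (f w) 0; first by rewrite /rejected_after /= ler0_sqrtr ?ltW //; left.
move=> rej; right; exists (Num.sqrt (Num.sqrt (f w))); rewrite /= f_upd upd_in.
rewrite (exprM _ 2 2) !sqr_sqrtr ?sqrtr_ge0 // subrr; split=> //.
by rewrite /rejected_after /= !evals_upd // upd_in sqr_sqrtr ?sqrtr_ge0.
Qed.

End NodeProjections.

Lemma rejection_projected_leaf b : rejection_projected (Leaf b).
Proof.
move=> m inp env _ _; case: b.
  apply: (@eq_zero_projections _ _ _ _ _ set0%classic) => //.
  by apply: zero_projections_leq (zero_projections0 R 8 m m); rewrite ?leq_addr.
by apply: (@eq_zero_projections _ _ _ _ _ setT) => //; exact: zero_projectionsT.
Qed.

Lemma rejection_projected_op o x y T : rejection_projected T -> rejection_projected (Op o x y T).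
Proof.
move=> T_projected m inp env inp_affine env_affine.
set f := operand_fun inp env x; set g := operand_fun inp env y.
have pf : polyfun m 1 f by apply: polyfun_operand.
have pg : polyfun m 1 g by apply: polyfun_operand.
apply: (@eq_zero_projections _ _ _ _ _
    (rejected_after T inp env (fun w => binop_val o (f w) (g w)))) => [w|].
  by rewrite /rejected /= !operand_valE.
case: o => /=; last exact: rejected_after_div_projected.
- apply: rejected_after_poly_projected => //; apply: polyfun_add.
    exact: polyfun_leq pf.
  exact: polyfun_leq pg.
- apply: rejected_after_poly_projected => //; apply: polyfun_sub.
    exact: polyfun_leq pf.
  exact: polyfun_leq pg.
- apply: rejected_after_poly_projected => //.
  exact: polyfun_leq (polyfun_mul pf pg).
Qed.

Lemma rejection_projected_sqrt x T : rejection_projected T -> rejection_projected (Sqrt x T).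
Proof.
move=> T_projected m inp env inp_affine env_affine.
apply: (@eq_zero_projections _ _ _ _ _
    (rejected_after T inp env (fun w => Num.sqrt (operand_fun inp env x w)))) => [w|].
  by rewrite /rejected /= operand_valE RsqrtE.
by apply: rejected_after_sqrt_projected => //; apply: polyfun_operand.
Qed.

Lemma act_eval_branch x Tl Te Tg inp env :
  act_eval (Branch x Tl Te Tg) inp env =
  let v := operand_val inp env x in
  if v < 0 then act_eval Tl inp env else
  if v == 0 then act_eval Te inp env else act_eval Tg inp env.
Proof.
rewrite /=; case: total_order_T => [[/RltP ->//|->]|/RltP v_gt0].
  by rewrite ltxx eqxx.
by rewrite ltNge (ltW v_gt0) /= gt_eqF.
Qed.

Lemma rejection_projected_branch x Tl Te Tg :
  rejection_projected Tl -> rejection_projected Te -> rejection_projected Tg ->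
  rejection_projected (Branch x Tl Te Tg).
Proof.
move=> Tl_projected Te_projected Tg_projected m inp env inp_affine env_affine.
set h := maxn (act_depth Tl) (maxn (act_depth Te) (act_depth Tg)).
have subtree T i : rejection_projected T -> (act_depth T <= h)%N -> (m <= i <= m.+1)%N ->
    zero_projections 8 i (m.+2 + h.*2) (3 ^ h) (rejected T inp env).
  move=> T_projected Th /andP[mi im].
  have := T_projected _ _ _ (affine_leq mi inp_affine) (affine_leq mi env_affine).
  by apply: zero_projections_leq => //; [lia|rewrite leq_exp2l].
have rejected_upd T w t : rejected T inp env (upd w m t) <-> rejected T inp env w.
  by rewrite /rejected /= !(evals_upd inp_affine env_affine).
have [Tl_h Te_h Tg_h] : [/\ act_depth Tl <= h, act_depth Te <= h & act_depth Tg <= h]%N.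
  by rewrite /h; split; lia.
have mM : (m < m.+2 + h.*2)%N by lia.
rewrite -[act_depth _]/h.+1 expnS (_ : m + _ = m.+2 + h.*2)%N; last by lia.
apply: eq_zero_projections (zero_projections_trichotomy mM (isT : (1.+2.*2 <= 8)%N)
  (polyfun_operand inp_affine env_affine x) (rejected_upd Tl) (rejected_upd Tg)
  (subtree Tl _ Tl_projected Tl_h _) (subtree Te _ Te_projected Te_h _)
  (subtree Tg _ Tg_projected Tg_h _)) => [w|||]; rewrite ?leqnn ?leqnSn //.
by rewrite /rejected /mkset act_eval_branch operand_valE /=; case: ltgtP.
Qed.

Lemma act_rejection_projected T : rejection_projected T.
Proof.
elim: T => [b|o x y T IHT|x T IHT|x Tl IHl Te IHe Tg IHg].
- exact: rejection_projected_leaf.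
- exact: rejection_projected_op.
- exact: rejection_projected_sqrt.
- exact: rejection_projected_branch.
Qed.

Lemma card_boxes_act_depth k (I : finType) (lo hi : I -> nat -> R) inp T : affine k inp ->
  trivIset setT (fun a => box k (lo a) (hi a)) ->
  (forall a, exists2 w, box k (lo a) (hi a) w & ~~ act_eval T (evals inp w) [::]) ->
  (forall a w, box_wall k (lo a) (hi a) w -> act_eval T (evals inp w) [::]) ->
  (#|I| <= 3 ^ act_depth T * 9 ^ (k + (act_depth T).*2))%N.
Proof.
move=> inp_affine disj rejects accepts.
have env_affine : affine k [::] by move=> i; rewrite nth_nil; apply: polyfun_cst.
apply: (@card_boxes_zero_projections _ k _ 9 _ (rejected T inp [::]) _ lo hi) => //.
- exact: leq_addr.
- apply: (zero_projections_leq (leqnSn 8) (leqnn _) (leqnn _)).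
  exact: act_rejection_projected inp_affine env_affine.
- by move=> a w /accepts accepted /negP.
Qed.

(** * Tours through points on two lines *)

Definition short_edge (pts : nat -> R * R) (B : R) : rel nat :=
  fun i j => edist (pts i) (pts j) <= B.

Lemma edistE p q : edist p q = Num.sqrt ((p.1 - q.1) ^+ 2 + (p.2 - q.2) ^+ 2).
Proof. by rewrite /edist RsqrtE !expr2. Qed.

Lemma short_edge_sym pts B : symmetric (short_edge pts B).
Proof.
by move=> i j; rewrite /short_edge !edistE -sqrrN opprB -[X in _ + X]sqrrN opprB.
Qed.

Lemma bottleneck_leP pts t B : bottleneck_le pts t B <-> path.cycle (short_edge pts B) t.
Proof.
case: t => [|x p]; first by split=> // _ k.
have nth_next i : (i <= size p)%N ->
    nth 0%N (rcons p x) i = nth 0%N (x :: p) (i.+1 %% size (x :: p)).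
  move=> ip; rewrite nth_rcons /=; case: ltngtP ip => // [ip|->] _.
    by rewrite modn_small.
  by rewrite modnn.
split=> [short|/(pathP 0%N) short i /= ip].
  apply/(pathP 0%N) => i; rewrite size_rcons ltnS => ip.
  rewrite nth_next // -rcons_cons nth_rcons /= ltnS ip.
  by apply/RleP/short.
have := short i; rewrite size_rcons => /(_ ip); rewrite nth_next //.
by rewrite -rcons_cons nth_rcons ip => /RleP.
Qed.

Lemma path_crossing (T : eqType) (e : rel T) (P : pred T) x p :
  path e x p -> P x -> ~~ P (last x p) ->
  exists y z, [/\ y \in belast x p, z \in p, e y z, P y & ~~ P z].
Proof.
elim: p x => [|y p IHp] x /=; first by move=> _ ->.
move=> /andP[exy py] Px Pl; have [Py|Py] := boolP (P y); last first.
  by exists x, y; split=> //; rewrite inE eqxx.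
have [u [v [up vp euv Pu Pv]]] := IHp y py Py Pl.
by exists u, v; split=> //; rewrite inE ?up ?vp orbT.
Qed.

Lemma path_complete (T : Type) (e : rel T) (P : pred T) x p :
  (forall y z, P y -> P z -> e y z) -> all P (x :: p) -> path e x p.
Proof.
by move=> eP; elim: p x => //= y p IHp x /and3P[Px Py Pp]; rewrite eP // IHp //= Py.
Qed.

Definition two_lines (c : nat) (B : R) (h : nat -> R) (i : nat) : R * R :=
  (if (i <= c)%N then 0 else B, h i).

Section TwoLines.
Context (n c : nat) (B : R) (h : nat -> R).
Hypothesis B_gt0 : 0 < B.

Let short : rel nat := short_edge (two_lines c B h) B.

Lemma short_edge_same_line i j : (i <= c)%N = (j <= c)%N -> short i j = (`|h i - h j| <= B).
Proof.
by move=> ij; rewrite /short /short_edge edistE /= ij subrr expr0n add0r sqrtr_sqr.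
Qed.

Lemma short_edge_across i j : (i <= c < j)%N -> short i j = (h i == h j).
Proof.
move=> /andP[ic cj]; rewrite /short /short_edge edistE /= ic leqNgt cj /= sub0r sqrrN.
rewrite -{2}(ger0_norm (ltW B_gt0)) -sqrtr_sqr ler_sqrt ?sqr_ge0 //.
by rewrite gerDl exprn_even_le0 //= subr_eq0.
Qed.

Definition bridge_tour (i j : nat) : seq nat :=
  0%N :: [seq x <- iota 1 (n - 2) | (x != i) && (x != j)] ++ [:: n.-1; j; i].

Lemma bridge_tour_pyramidal i j : (0 < i < j)%N -> (j < n.-1)%N ->
  pyramidal n (bridge_tour i j).
Proof.
move=> ij jn; split.
  apply: uniq_perm; [|exact: iota_uniq|move=> x].
    rewrite /= mem_cat cat_uniq filter_uniq ?iota_uniq //= !inE !mem_filter !mem_iota.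
    by lia.
  by rewrite inE mem_cat mem_filter !inE !mem_iota; lia.
exists [seq x <- iota 1 (n - 2) | (x != i) && (x != j)], [:: j; i].
split=> //; split; last by rewrite /=; lia.
by apply: sorted_filter; [exact: ltn_trans|exact: iota_ltn_sorted].
Qed.

Lemma bridge_tourE i j : (i < c)%N -> (c.+1 < j < n.-1)%N ->
  let kept x := (x != i) && (x != j) in
  bridge_tour i j = (0%N :: [seq x <- iota 1 c.-1 | kept x] ++ [:: c]) ++
    (c.+1 :: [seq x <- iota c.+2 (n - c - 3) | kept x] ++ [:: n.-1; j]) ++ [:: i].
Proof.
move=> ic jn kept; rewrite /bridge_tour (_ : n - 2 = c.-1 + (1 + (1 + (n - c - 3))))%N.
  rewrite !iotaD !filter_cat /= (_ : 1 + c.-1 = c)%N; last by lia.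
  by rewrite !addn1 !ifT /= -?catA //; lia.
by lia.
Qed.

Lemma bridge_tour_short i j : (forall x y, (x < n)%N -> (y < n)%N -> `|h x - h y| <= B) ->
  h c = h c.+1 -> (0 < i < c)%N -> (c.+1 < j < n.-1)%N -> h i = h j ->
  bottleneck_le (two_lines c B h) (bridge_tour i j) B.
Proof.
move=> h_close h_bridge ic jn hij; apply/bottleneck_leP; rewrite -/short.
have left_short x y : (x <= c)%N -> (y <= c)%N -> short x y.
  move=> xc yc; rewrite short_edge_same_line ?xc ?yc //.
  by apply: h_close; lia.
have right_short x y : (c < x < n)%N -> (c < y < n)%N -> short x y.
  move=> xc yc; rewrite short_edge_same_line; last by lia.
  by apply: h_close; lia.
rewrite bridge_tourE; [|lia|lia].
set left := [seq x <- iota 1 _ | _]; set right := [seq x <- iota c.+2 _ | _].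
rewrite /= rcons_cat cat_path last_cat /= rcons_cat [path _ c.+1 _]cat_path last_cat /=.
apply/and5P; split.
- apply: (path_complete (P := fun x => (x <= c)%N)) => //=.
  by rewrite all_cat /= leqnn !andbT; apply/allP => x; rewrite mem_filter mem_iota; lia.
- by rewrite short_edge_across ?h_bridge //; lia.
- apply: (path_complete (P := fun x => (c < x < n)%N)) => //=.
  rewrite all_cat /=; apply/and3P; split; [lia| |lia].
  by apply/allP => x; rewrite mem_filter mem_iota; lia.
- by rewrite /short short_edge_sym -/short short_edge_across ?hij //; lia.
- by rewrite andbT left_short //; lia.
Qed.

Hypothesis level_only_bridge :
  forall i j, (i <= c < j)%N -> (j < n)%N -> h i = h j -> i = c.

Lemma path_across_bridge x p y : path short x (rcons p y) ->
  all (fun z => z < n)%N (rcons p y) -> (x <= c < y)%N -> c \in x :: p.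
Proof.
move=> short_p /allP p_lt_n /andP[xc cy].
have [||u [v [up vp uv uc vc]]] := path_crossing (P := fun z => (z <= c)%N) short_p.
- by [].
- by rewrite last_rcons -ltnNge.
rewrite -ltnNge in vc; rewrite belast_rcons in up.
have ucv : (u <= c < v)%N by rewrite uc.
suff <- : u = c by [].
have /eqP huv : h u == h v by rewrite -short_edge_across.
exact: level_only_bridge ucv (p_lt_n _ vp) huv.
Qed.

(* Both halves of a tour cross between the lines, and both crossings would use [c]. *)
Lemma two_lines_no : (0 < c < n.-1)%N -> ~ BPTSP_yes n (two_lines c B h) B.
Proof.
move=> c_in [t [[t_perm [a [b [tE _]]]] /bottleneck_leP]]; rewrite {t}tE in t_perm *.
rewrite -/short /= rcons_cat rcons_cons -cat_rcons cat_path last_rcons => /andP[short_a short_b].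
have t_lt_n x : x \in 0%N :: a ++ n.-1 :: b -> (x < n)%N.
  by rewrite (perm_mem t_perm) mem_iota.
have c_a : c \in 0%N :: a.
  apply: path_across_bridge short_a _ _; last by lia.
  apply/allP => x; rewrite mem_rcons => xa; apply: t_lt_n; move: xa.
  by rewrite !(inE, mem_cat) => /orP[->|->]; rewrite ?orbT.
have c_b : c \in 0%N :: rev b.
  apply: (@path_across_bridge 0%N (rev b) n.-1); last by lia.
    move: short_b; rewrite -rev_path last_rcons belast_rcons rev_cons.
    by rewrite (eq_path (e' := short)) // => x y; apply: short_edge_sym.
  apply/allP => x; rewrite mem_rcons inE mem_rev => xb; apply: t_lt_n.
  by rewrite !(inE, mem_cat) xb !orbT.
have := perm_uniq t_perm; rewrite iota_uniq /= cat_uniq => /and4P[_ _ /negP[]].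
move: c_a c_b; rewrite !inE mem_rev => /predU1P[|ca] => [|/predU1P[|cb]]; [lia..|].
by apply/hasP; exists c => //; rewrite inE cb orbT.
Qed.

End TwoLines.

(** * Cubes indexed by permutations *)

Section PermutationCubes.
Context (k : nat).
Implicit Types (s t : 'S_k) (w : nat -> R) (i j : nat).

Definition perm_at s j : nat := if insub j is Some j' then s j' else 0%N.

Definition cube_lo s j : R := (perm_at s j).*2.+1%:R.
Definition cube_hi s j : R := (perm_at s j).*2.+2%:R.

Definition cube s : set (nat -> R) := box k (cube_lo s) (cube_hi s).

Lemma perm_at_lt s j : (j < k)%N -> (perm_at s j < k)%N.
Proof. by move=> jk; rewrite /perm_at insubT /=. Qed.

Lemma perm_at_inj s i j : (i < k)%N -> (j < k)%N -> perm_at s i = perm_at s j -> i = j.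
Proof.
move=> ik jk; rewrite /perm_at !insubT /= => /val_inj/perm_inj.
by move=> /(congr1 val).
Qed.

Lemma cube_common_value s t w w' i j : cube s w -> cube t w' -> (i < k)%N -> (j < k)%N ->
  w i = w' j -> perm_at s i = perm_at t j.
Proof.
move=> ws wt ik jk wij; have /andP[lo_i hi_i] := ws i ik; have /andP[lo_j hi_j] := wt j jk.
rewrite wij in lo_i hi_i; have := le_trans lo_i hi_j; have := le_trans lo_j hi_i.
by rewrite /cube_lo /cube_hi !ler_nat; lia.
Qed.

Lemma cube_coord_inj s w i j : cube s w -> (i < k)%N -> (j < k)%N -> w i = w j -> i = j.
Proof.
move=> ws ik jk wij; apply: (@perm_at_inj s) => //.
exact: (cube_common_value ws ws).
Qed.

Lemma trivIset_cubes : trivIset setT cube.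
Proof.
move=> s t _ _ [w [ws wt]]; apply/permP => j; apply: val_inj.
have := cube_common_value ws wt (ltn_ord j) (ltn_ord j) erefl.
by rewrite /perm_at valK.
Qed.

Lemma cube_bounds s w j : cube s w -> (j < k)%N -> 1 <= w j <= k.*2%:R.
Proof.
move=> ws jk; have /andP[lo hi] := ws j jk; have sk := perm_at_lt s jk.
by rewrite (le_trans _ lo) ?ler1n // (le_trans hi) // ler_nat; lia.
Qed.

Lemma cube_interior_not_nat s w j a : box_interior k (cube_lo s) (cube_hi s) w ->
  (j < k)%N -> w j <> a%:R.
Proof. by move=> wi jk wj; have := wi j jk; rewrite wj !ltr_nat; lia. Qed.

Lemma cube_wall_nat s w : box_wall k (cube_lo s) (cube_hi s) w ->
  exists j a, [/\ (j < k)%N, (0 < a <= k.*2)%N & w j = a%:R].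
Proof.
move=> [_ [j jk wj]]; have sk := perm_at_lt s jk; exists j.
by case: wj => ->; [exists (perm_at s j).*2.+1|exists (perm_at s j).*2.+2]; split=> //; lia.
Qed.

Definition cube_center s : nat -> R := fun j => cube_lo s j + 2^-1.

Lemma cube_center_interior s : box_interior k (cube_lo s) (cube_hi s) (cube_center s).
Proof.
move=> j _; rewrite /cube_center (_ : cube_hi s j = cube_lo s j + 1).
  by apply/andP; split; lra.
by rewrite /cube_hi -addn1 natrD.
Qed.

End PermutationCubes.

(** * The hard instances *)

(* The first line carries the indices up to [L+1] and the second one the remaining ones.  The
   indices [L+1] and [L+2] form the bridge at height 0; only the heights of the [k] indices
   from [L+3] on are free. *)
Definition hard_height (L k : nat) (w : nat -> R) (i : nat) : R :=
  if i == 0%N then -1 else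
  if (i <= L)%N then i%:R else
  if (i <= L.+2)%N then 0 else
  if (i < L + 3 + k)%N then w (i - (L + 3))%N else -2%:R.

Variant hard_height_spec (L k : nat) (w : nat -> R) (i : nat) : R -> Prop :=
| HardFirst of i = 0%N : hard_height_spec L k w i (-1)%R
| HardLeft of (0 < i <= L)%N : hard_height_spec L k w i i%:R%R
| HardBridge of (L < i <= L.+2)%N : hard_height_spec L k w i 0%R
| HardFree of (L.+2 < i)%N & (i - (L + 3) < k)%N :
    hard_height_spec L k w i (w (i - (L + 3))%N)
| HardLast of (L + 3 + k <= i)%N : hard_height_spec L k w i (-2%:R)%R.

Lemma hard_heightP L k w i : hard_height_spec L k w i (hard_height L k w i).
Proof.
rewrite /hard_height; case: eqP => [i0|i0]; first by constructor.
case: (leqP i L) => iL; first by constructor; lia.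
case: (leqP i L.+2) => iL2; first by constructor; lia.
by case: (ltnP i (L + 3 + k)) => iLk; constructor; lia.
Qed.

Section HardInstance.
Context (L k : nat).
Hypothesis kL : (k.*2 <= L)%N.
Implicit Types (s : 'S_k) (w : nat -> R).

Let n := (L + k + 4)%N.
Let B : R := L.+2%:R.
Let h := hard_height L k.
Let pts w := two_lines L.+1 B (h w).

Let B_gt0 : 0 < B.
Proof. by rewrite ltr0n. Qed.

Lemma hard_height_bounds s w i : cube s w -> -2%:R <= h w i <= L%:R.
Proof.
move=> ws; have L_ge0 := ler0n R L.
rewrite /h; case: hard_heightP => [_|iL|_|_ jk|_]; try by apply/andP; split; lra.
  have : i%:R <= L%:R :> R by rewrite ler_nat; lia.
  have := ler0n R i.
  by move=> *; apply/andP; split; lra.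
have : k.*2%:R <= L%:R :> R by rewrite ler_nat.
by have := cube_bounds ws jk; lra.
Qed.

Lemma hard_height_diff s w i j : cube s w -> `|h w i - h w j| <= B.
Proof.
move=> ws; have := hard_height_bounds i ws; have := hard_height_bounds j ws.
by rewrite /B -addn2 natrD ler_norml; lra.
Qed.

Lemma hard_height_neq s w i j : cube s w -> (i < n)%N -> (j < n)%N ->
  (i <= L.+1)%N = (j <= L.+1)%N -> i <> j -> h w i <> h w j.
Proof.
move=> ws ni nj side ij; rewrite /h; rewrite /n in ni nj.
case: (hard_heightP L k w i) => [i0|i0|i0|i0 ik|i0];
  case: (hard_heightP L k w j) => [j0|j0|j0|j0 jk|j0]; try lia; try lra.
- by have := ler0n R j; lra.
- by have := ler0n R i; lra.
- by move=> /eqP; rewrite eqr_nat => /eqP.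
- by have /andP[i_gt0 _] := i0; have := ler1n R i; rewrite i_gt0; lra.
- by have /andP[j_gt0 _] := j0; have := ler1n R j; rewrite j_gt0; lra.
- by have := cube_bounds ws jk; lra.
- by have := cube_bounds ws ik; lra.
- by move=> /(cube_coord_inj ws ik jk); lia.
- by have := cube_bounds ws ik; lra.
- by have := cube_bounds ws jk; lra.
Qed.

Lemma hard_points_distinct s w i j : cube s w -> (i < n)%N -> (j < n)%N -> i <> j ->
  pts w i <> pts w j.
Proof.
move=> ws ni nj ij [x_eq]; apply: hard_height_neq ws ni nj _ ij.
have B_neq0 : B <> 0 by apply/eqP; rewrite gt_eqF.
by move: x_eq; case: leqP => _; case: leqP => _ // e; case: B_neq0.
Qed.

Lemma hard_interior_no s w : box_interior k (cube_lo s) (cube_hi s) w ->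
  ~ BPTSP_yes n (pts w) B.
Proof.
move=> wi; have ws := box_interior_sub wi.
apply: two_lines_no => [//|i j icj jn|]; last by rewrite /n; lia.
rewrite /h; rewrite /n in jn.
case: (hard_heightP L k w i) => [i0|i0|i0|i0 ik|i0];
  case: (hard_heightP L k w j) => [j0|j0|j0|j0 jk|j0]; try lia;
  move=> level; exfalso; move: level; try lra.
- by have := cube_bounds ws jk; lra.
- by move=> /eqP; rewrite pnatr_eq0; lia.
- by move=> level; apply: cube_interior_not_nat wi jk (esym level).
- by have := ler0n R i; lra.
Qed.

Lemma hard_wall_yes s w : box_wall k (cube_lo s) (cube_hi s) w -> BPTSP_yes n (pts w) B.
Proof.
move=> wall; have [j [a [jk aL wj]]] := cube_wall_nat wall; have ws : cube s w by case: wall.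
exists (bridge_tour n a (L + 3 + j)); split.
  by apply: bridge_tour_pyramidal; rewrite /n; lia.
apply: bridge_tour_short => //; try by rewrite /n; lia.
- by move=> x y _ _; apply: hard_height_diff ws.
- rewrite /h; case: (hard_heightP L k w L.+1); try lia.
  by case: (hard_heightP L k w L.+2); try lia.
rewrite /h; case: (hard_heightP L k w a); try lia.
case: (hard_heightP L k w (L + 3 + j)); try lia.
by rewrite addKn wj.
Qed.

Let inputs : seq ((nat -> R) -> R) :=
  flatten [seq [:: (fun w => (pts w i).1); (fun w => (pts w i).2)] | i <- iota 0 n]
  ++ [:: fun=> B].

Lemma evals_inputs w : evals inputs w = encode n (pts w) B.
Proof.
rewrite /evals /inputs /encode map_cat map_flatten -map_comp.
by congr (flatten _ ++ _).
Qed.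

Lemma affine_inputs : affine k inputs.
Proof.
move=> i; rewrite /inputs.
elim: (iota 0 n) i => [|x xs IHxs] [|[|i]] /=; try exact: polyfun_cst; last exact: IHxs.
rewrite /h /hard_height.
case: eqP => _; first exact: polyfun_cst.
case: (leqP x L) => _; first exact: polyfun_cst.
case: (leqP x L.+2) => [_|x2]; first exact: polyfun_cst.
case: (ltnP x (L + 3 + k)) => [xk|_]; last exact: polyfun_cst.
by apply: polyfun_var; lia.
Qed.

Lemma fact_le_act_depth T : decides_BPTSP n T ->
  (k`! <= 3 ^ act_depth T * 9 ^ (k + (act_depth T).*2))%N.
Proof.
move=> T_decides.
have T_correct s w : cube s w ->
    act_eval T (evals inputs w) [::] <-> BPTSP_yes n (pts w) B.
  move=> ws; rewrite evals_inputs; apply: T_decides; first exact/RltP.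
  by move=> i j ni nj ij; apply: hard_points_distinct ws _ _ _.
rewrite -card_Sn.
apply: (card_boxes_act_depth affine_inputs (@trivIset_cubes k)) => [s|s w wall].
  have interior := @cube_center_interior k s.
  exists (cube_center s); first exact: box_interior_sub.
  apply/negP => /(T_correct s _ (box_interior_sub interior)).
  exact: hard_interior_no interior.
by apply/(T_correct s); [case: wall|exact: hard_wall_yes wall].
Qed.

End HardInstance.

Lemma expn_le_fact q j : (q ^ j <= (q + j)`!)%N.
Proof.
elim: j => [|j IHj]; first by rewrite expn0 fact_gt0.
by rewrite addnS factS expnS leq_mul //; lia.
Qed.

Lemma decides_BPTSP_expn_le n T : (8 * 3 ^ 8 <= n)%N -> decides_BPTSP n T ->
  (n ^ n <= 3 ^ (320 * act_depth T))%N.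
Proof.
set h := act_depth T => n_large T_decides; pose q := (n %/ 8)%N.
have q_large : (3 ^ 8 <= q)%N by rewrite leq_divRL // mulnC.
have qn : (q * 8 <= n)%N by apply: leq_trunc_div.
have nq : (n <= 16 * q)%N by have := ltn_ceil n (isT : 0 < 8)%N; rewrite -/q; lia.
have q_ge16 : (16 <= q)%N by apply: leq_trans q_large.
have qq_le : (q ^ q <= 3 ^ (4 * q + 5 * h))%N.
  have nE : (n = (n - q.*2 - 4) + q.*2 + 4)%N by lia.
  have := @fact_le_act_depth (n - q.*2 - 4) q.*2; rewrite -nE => /(_ _ T T_decides) fact_le.
  apply: leq_trans (expn_le_fact q q) _; rewrite addnn; apply: leq_trans (fact_le _) _.
    by lia.
  by rewrite -[9%N]/(3 ^ 2)%N -expnM -expnD leq_exp2l //; lia.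
have qq_le_depth : (q ^ q <= 3 ^ (10 * h))%N.
  have q_gt0 : (0 < q ^ q)%N by rewrite expn_gt0; lia.
  rewrite -(leq_pmul2r q_gt0); apply: leq_trans (leq_mul qq_le qq_le) _.
  rewrite -expnD (_ : _ + _ = 10 * h + 8 * q)%N; last by lia.
  by rewrite expnD (expnM 3 8) leq_mul // leq_exp2r //; lia.
apply: (@leq_trans ((q ^ 2) ^ (16 * q))).
  by apply: leq_trans (leq_pexp2l _ nq) _; [lia|rewrite leq_exp2r; nia].
rewrite -expnM (_ : 2 * _ = q * 32)%N; last by lia.
rewrite (expnM q) (_ : 320 * h = 10 * h * 32)%N; last by lia.
by rewrite (expnM 3) leq_exp2r.
Qed.

Lemma ln_expn_le (R : realType) a b x y : (0 < a)%N -> (0 < b)%N -> (a ^ x <= b ^ y)%N ->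
  x%:R * exp.ln a%:R <= y%:R * exp.ln b%:R :> R.
Proof.
move=> a_gt0 b_gt0 ab; rewrite !mulr_natl -!exp.lnXn ?ltr0n //.
by rewrite exp.ler_ln ?posrE ?exprn_gt0 ?ltr0n // -!natrX ler_nat.
Qed.

Theorem theorem13 :
  exists c : R, Rlt R0 c /\
  exists N : nat, forall n : nat, (N <= n)%N ->
    forall T : act, decides_BPTSP n T ->
      Rle (Rmult (Rmult c (INR n)) (ln (INR n))) (INR (act_depth T)).
Proof.
have ln3_gt0 : 0 < exp.ln 3%:R :> R by rewrite exp.ln_gt0 ?ltr1n.
exists (320%:R * exp.ln 3%:R)^-1; split; first by apply/RltP; rewrite invr_gt0 mulr_gt0.
exists (8 * 3 ^ 8)%N => n n_large T T_decides.
have n_gt0 : (0 < n)%N by apply: leq_trans n_large.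
have := ln_expn_le R n_gt0 (isT : 0 < 3)%N (decides_BPTSP_expn_le n_large T_decides).
rewrite natrM mulrAC => n_ln_n; apply/RleP; rewrite !INRE RlnE !RmultE.
by rewrite -mulrA mulrC ler_pdivrMr ?mulr_gt0 // [_ * (_ * _)]mulrC.
Qed.
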